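(* Let $\mathcal G_\bullet$ and $\mathcal G'_\bullet$ be two biequivalent coherent 2-groups, i.e. there exists a biequivalence between the bicategories $B\mathcal G_\bullet$ and $B\mathcal G'_\bullet$. Then the bicategories $2\mathsf{Rep}(\mathcal G_\bullet)$ and $2\mathsf{Rep}(\mathcal G'_\bullet)$ are biequivalent.
   Context: $k$ is a field of characteristic zero. A coherent (Lie) 2-group $\mathcal G_\bullet=(\mathcal G_1\rightrightarrows\mathcal G_0)$ is a group object in the bicategory of (Lie) groupoids: a (Lie) groupoid with a multiplication $m:\mathcal G_\bullet\times\mathcal G_\bullet\to\mathcal G_\bullet$ and unit $u:*\to\mathcal G_\bullet$ such that $(\mathrm{pr}_1,m)$ is an equivalence, together with invertible 2-morphisms $a:m\circ(m\times1)\Rightarrow m\circ(1\times m)$, $l:m\circ(u\times1)\Rightarrow1$, $r:m\circ(1\times u)\Rightarrow1$ satisfying the pentagon and triangle identities. $B\mathcal G_\bullet$ is its delooping: the bicategory with a single object $*$, hom-category $\mathcal G_\bullet$ and horizontal composition $m$. $2\mathsf{Vect}$ is the strict 2-category whose objects are $k$-prelinear categories (categories whose hom-sets are $k$-vector spaces with $k$-bilinear composition), whose 1-morphisms are $k$-linear functors and whose 2-morphisms are natural transformations. A 2-representation of $\mathcal G_\bullet$ is a pseudofunctor $B\mathcal G_\bullet\to2\mathsf{Vect}$, and $2\mathsf{Rep}(\mathcal G_\bullet)$ is the bicategory of pseudofunctors $B\mathcal G_\bullet\to2\mathsf{Vect}$, strong transformations and modifications. A biequivalence between bicategories $\mathcal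 A,\mathcal B$ consists of pseudofunctors $\rho:\mathcal A\to\mathcal B$, $\iota:\mathcal B\to\mathcal A$ and strong transformations $\eta:\mathrm{id}_{\mathcal A}\Rightarrow\iota\circ\rho$, $\epsilon:\rho\circ\iota\Rightarrow\mathrm{id}_{\mathcal B}$ for which there exist strong transformations $\eta':\iota\circ\rho\Rightarrow\mathrm{id}_{\mathcal A}$, $\epsilon':\mathrm{id}_{\mathcal B}\Rightarrow\rho\circ\iota$ and invertible modifications $1\cong\eta'\circ\eta$, $\eta\circ\eta'\cong1$, $1\cong\epsilon'\circ\epsilon$, $\epsilon\circ\epsilon'\cong1$. *)

(* Defs.v *)
From mathcomp Require Import all_boot all_algebra.
From mathcomp Require Import boolp.

Set Implicit Arguments.
Unset Strict Implicit.
Unset Printing Implicit Defensive.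

Declare Scope cat_scope.
Delimit Scope cat_scope with cat.
Local Open Scope cat_scope.
#[local] Obligation Tactic := simpl; try by [].

Reserved Notation "x ~> y" (at level 80, no associativity).
Reserved Notation "g • f" (at level 50, left associativity).
Reserved Notation "g ∘ f" (at level 40, left associativity).
Reserved Notation "b ⋆ a" (at level 40, left associativity).
Reserved Notation "g ◁ a" (at level 40, left associativity).
Reserved Notation "b ▷ f" (at level 40, left associativity).

Record category := Cat {
  cat_ob :> Type;
  mor : cat_ob -> cat_ob -> Type;
  idc : forall x, mor x x;
  cmp : forall x y z, mor y z -> mor x y -> mor x z;
  cmp1m : forall x y (f : mor x y), cmp (idc y) f = f;
  cmpm1 : forall x y (f : mor x y), cmp f (idc x) = f;
  cmpA : forall x y z t (h : mor z t) (g : mor y z) (f : mor x y),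
    cmp h (cmp g f) = cmp (cmp h g) f }.

Arguments mor {_} _ _.
Arguments idc {_} _.
Arguments cmp {_ x y z} _ _.
Arguments cmpA {_ x y z t} _ _ _.

Notation "x ~> y" := (mor x y) : cat_scope.
Notation "g • f" := (cmp g f) : cat_scope.

Record iso (C : category) (x y : C) := Iso {
  fwd :> x ~> y;
  bwd : y ~> x;
  bwdK : bwd • fwd = idc x;
  fwdK : fwd • bwd = idc y }.

Record functor (C D : category) := Functor {
  fob :> C -> D;
  fmap : forall x y, x ~> y -> fob x ~> fob y;
  fmap1 : forall x, fmap (idc x) = idc (fob x);
  fmapM : forall x y z (g : y ~> z) (f : x ~> y),
    fmap (g • f) = fmap g • fmap f }.

Arguments fmap {C D} _ {x y} _.

Section IsoOps.
Variables (C D : category).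

Definition iso_id (x : C) : iso x x := Iso (cmp1m (idc x)) (cmp1m (idc x)).

Definition iso_inv (x y : C) (i : iso x y) : iso y x := Iso (fwdK i) (bwdK i).

Program Definition iso_cmp (x y z : C) (j : iso y z) (i : iso x y) : iso x z :=
  {| fwd := j • i; bwd := bwd i • bwd j |}.
Next Obligation.
by move=> x y z j i; rewrite cmpA -(cmpA (bwd i)) bwdK cmpm1 bwdK.
Qed.
Next Obligation.
by move=> x y z j i; rewrite cmpA -(cmpA (fwd j)) fwdK cmpm1 fwdK.
Qed.

Program Definition iso_fmap (F : functor C D) (x y : C) (i : iso x y) :
    iso (F x) (F y) :=
  {| fwd := fmap F i; bwd := fmap F (bwd i) |}.
Next Obligation. by move=> *; rewrite -fmapM bwdK fmap1. Qed.
Next Obligation. by move=> *; rewrite -fmapM fwdK fmap1. Qed.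

Lemma fwdK_l (x y z : C) (i : iso x y) (f : y ~> z) : f • i • bwd i = f.
Proof. by rewrite -cmpA fwdK cmpm1. Qed.

Lemma bwdK_l (x y z : C) (i : iso x y) (f : x ~> z) : f • bwd i • i = f.
Proof. by rewrite -cmpA bwdK cmpm1. Qed.

Lemma iso_epi (x y z : C) (i : iso x y) (f g : y ~> z) :
  f • i = g • i -> f = g.
Proof. by move=> e; rewrite -(fwdK_l i f) e fwdK_l. Qed.

Lemma iso_mono (x y z : C) (i : iso y z) (f g : x ~> y) :
  i • f = i • g -> f = g.
Proof.
by move=> e; rewrite -(cmp1m f) -(cmp1m g) -(bwdK i) -!cmpA e.
Qed.

End IsoOps.

Arguments iso_id {C} _.

Record nat_iso (C D : category) (F G : functor C D) := NatIso {
  niso :> forall x, iso (F x) (G x);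
  nisoN : forall x y (f : x ~> y), niso y • fmap F f = fmap G f • niso x }.

Arguments niso {C D F G} _ _.

Section FunctorOps.
Variables C D E : category.

Program Definition functor_id : functor C C :=
  {| fob := fun x => x; fmap := fun _ _ f => f |}.

Program Definition functor_comp (G : functor D E) (F : functor C D) :
    functor C E :=
  {| fob := fun x => G (F x); fmap := fun _ _ f => fmap G (fmap F f) |}.
Next Obligation. by move=> *; rewrite !fmap1. Qed.
Next Obligation. by move=> *; rewrite !fmapM. Qed.

Program Definition functor_const (d : D) : functor C D :=
  {| fob := fun _ => d; fmap := fun _ _ _ => idc d |}.
Next Obligation. by move=> *; rewrite cmp1m. Qed.

Program Definition cat_prod : category :=
  {| cat_ob := C * D;
     mor := fun x y => ((x.1 ~> y.1) * (x.2 ~> y.2))%type;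
     idc := fun x => (idc x.1, idc x.2);
     cmp := fun _ _ _ g f => (g.1 • f.1, g.2 • f.2) |}.
Next Obligation. by move=> x y [f1 f2] /=; rewrite !cmp1m. Qed.
Next Obligation. by move=> x y [f1 f2] /=; rewrite !cmpm1. Qed.
Next Obligation. by move=> * /=; rewrite !cmpA. Qed.

End FunctorOps.

Arguments functor_id {C}.
Arguments functor_const {C D} _.

Section FunctorProd.
Variables C D E : category.

Program Definition functor_fst : functor (cat_prod C D) C :=
  {| fob := fun x => x.1; fmap := fun _ _ f => f.1 |}.

Program Definition functor_snd : functor (cat_prod C D) D :=
  {| fob := fun x => x.2; fmap := fun _ _ f => f.2 |}.

Program Definition functor_pair (F : functor C D) (G : functor C E) :
    functor C (cat_prod D E) :=
  {| fob := fun x => (F x, G x); fmap := fun _ _ f => (fmap F f, fmap G f) |}.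
Next Obligation. by move=> *; rewrite !fmap1. Qed.
Next Obligation. by move=> * /=; rewrite !fmapM. Qed.

End FunctorProd.

Arguments functor_fst {C D}.
Arguments functor_snd {C D}.

Program Definition cat_unit : category :=
  {| cat_ob := unit; mor := fun _ _ => unit;
     idc := fun _ => tt; cmp := fun _ _ _ _ _ => tt |}.
Next Obligation. by move=> ? ? []. Qed.
Next Obligation. by move=> ? ? []. Qed.

Definition is_equivalence (C D : category) (F : functor C D) : Prop :=
  exists G : functor D C,
    inhabited (nat_iso (functor_comp G F) functor_id) /\
    inhabited (nat_iso (functor_comp F G) functor_id).

(* For a "multiplication" M, the two iterated operations
   ((h, g), f) |-> M (M (h, g), f) and ((h, g), f) |-> M (h, M (g, f)). *)
Definition assoc_l (X Y Z XY T : category) (M : functor (cat_prod X Y) XY)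
    (N : functor (cat_prod XY Z) T) : functor (cat_prod (cat_prod X Y) Z) T :=
  functor_comp N (functor_pair (functor_comp M functor_fst) functor_snd).

Definition assoc_r (X Y Z YZ T : category) (M : functor (cat_prod Y Z) YZ)
    (N : functor (cat_prod X YZ) T) : functor (cat_prod (cat_prod X Y) Z) T :=
  functor_comp N
    (functor_pair (functor_comp functor_fst functor_fst)
       (functor_comp M
          (functor_pair (functor_comp functor_snd functor_fst) functor_snd))).

Record bicat_data := BicatData {
  bi_ob :> Type;
  bhom : bi_ob -> bi_ob -> category;
  bid : forall a, bhom a a;
  bcomp : forall a b c,
    functor (cat_prod (bhom b c) (bhom a b)) (bhom a c);
  bassoc : forall a b c d,
    nat_iso (assoc_l (bcomp b c d) (bcomp a b d))
            (assoc_r (bcomp a b c) (bcomp a c d));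
  blunit : forall a b,
    nat_iso (functor_comp (bcomp a b b)
               (functor_pair (functor_const (bid b)) functor_id))
            functor_id;
  brunit : forall a b,
    nat_iso (functor_comp (bcomp a a b)
               (functor_pair functor_id (functor_const (bid a))))
            functor_id }.

Arguments bhom {_} _ _.
Arguments bid {_} _.

Section BicatOps.
Variable B : bicat_data.

Definition comp1 (a b c : B) (g : bhom b c) (f : bhom a b) : bhom a c :=
  bcomp a b c (g, f).

Definition comp2 (a b c : B) (g g' : bhom b c) (f f' : bhom a b)
    (s : g ~> g') (t : f ~> f') : comp1 g f ~> comp1 g' f' :=
  @fmap _ _ (bcomp a b c) (g, f) (g', f') (s, t).

Definition asc (a b c d : B) (h : bhom c d) (g : bhom b c) (f : bhom a b) :
    iso (comp1 (comp1 h g) f) (comp1 h (comp1 g f)) :=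
  bassoc a b c d ((h, g), f).

Definition lun (a b : B) (f : bhom a b) : iso (comp1 (bid b) f) f :=
  blunit a b f.

Definition run (a b : B) (f : bhom a b) : iso (comp1 f (bid a)) f :=
  brunit a b f.

End BicatOps.

Arguments comp1 {B a b c} _ _ : simpl never.
Arguments comp2 {B a b c g g' f f'} _ _ : simpl never.
Arguments asc {B a b c d} _ _ _ : simpl never.
Arguments lun {B a b} _ : simpl never.
Arguments run {B a b} _ : simpl never.

Notation "g ∘ f" := (comp1 g f) : cat_scope.
Notation "b ⋆ a" := (comp2 b a) : cat_scope.
Notation "g ◁ a" := (comp2 (idc g) a) : cat_scope.
Notation "b ▷ f" := (comp2 b (idc f)) : cat_scope.

Record bicat := Bicat {
  bi_data :> bicat_data;
  pentagon : forall (a b c d e : bi_data)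
      (k : bhom d e) (h : bhom c d) (g : bhom b c) (f : bhom a b),
    (k ◁ asc h g f) • asc k (h ∘ g) f • (asc k h g ▷ f) =
    asc k h (g ∘ f) • asc (k ∘ h) g f;
  triangle : forall (a b c : bi_data) (g : bhom b c) (f : bhom a b),
    (g ◁ lun f) • asc g (bid b) f = run g ▷ f }.

Section BicatTheory.
Variable B : bicat.
Implicit Types a b c d : B.

Lemma comp2_1 a b c (g : bhom b c) (f : bhom a b) : g ◁ idc f = idc (g ∘ f).
Proof. exact: (@fmap1 _ _ (bcomp a b c) (g, f)). Qed.

Lemma comp2M a b c (g g' g'' : bhom b c) (f f' f'' : bhom a b)
    (s' : g' ~> g'') (s : g ~> g') (t' : f' ~> f'') (t : f ~> f') :
  (s' • s) ⋆ (t' • t) = (s' ⋆ t') • (s ⋆ t).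
Proof.
exact: (@fmapM _ _ (bcomp a b c) (g, f) (g', f') (g'', f'') (s', t') (s, t)).
Qed.

Lemma comp2_lM a b c (g : bhom b c) (f f' f'' : bhom a b)
    (t' : f' ~> f'') (t : f ~> f') : g ◁ (t' • t) = (g ◁ t') • (g ◁ t).
Proof. by rewrite -comp2M cmp1m. Qed.

Lemma comp2_rM a b c (g g' g'' : bhom b c) (f : bhom a b)
    (s' : g' ~> g'') (s : g ~> g') : (s' • s) ▷ f = (s' ▷ f) • (s ▷ f).
Proof. by rewrite -comp2M cmp1m. Qed.

Lemma comp2_lr a b c (g g' : bhom b c) (f f' : bhom a b)
    (s : g ~> g') (t : f ~> f') : s ⋆ t = (s ▷ f') • (g ◁ t).
Proof. by rewrite -comp2M cmp1m cmpm1. Qed.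

Lemma comp2_rl a b c (g g' : bhom b c) (f f' : bhom a b)
    (s : g ~> g') (t : f ~> f') : s ⋆ t = (g' ◁ t) • (s ▷ f).
Proof. by rewrite -comp2M cmp1m cmpm1. Qed.

Lemma asc_nat a b c d (h h' : bhom c d) (g g' : bhom b c) (f f' : bhom a b)
    (s : h ~> h') (t : g ~> g') (u : f ~> f') :
  asc h' g' f' • ((s ⋆ t) ⋆ u) = (s ⋆ (t ⋆ u)) • asc h g f.
Proof.
exact: (@nisoN _ _ _ _ (bassoc a b c d)
  ((h, g), f) ((h', g'), f') ((s, t), u)).
Qed.

Lemma lun_nat a b (f f' : bhom a b) (t : f ~> f') :
  lun f' • (bid b ◁ t) = t • lun f.
Proof. exact: (nisoN (blunit a b)). Qed.

Lemma run_nat a b (f f' : bhom a b) (t : f ~> f') :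
  run f' • (t ▷ bid a) = t • run f.
Proof. exact: (nisoN (brunit a b)). Qed.

Program Definition iso_comp2 a b c (g g' : bhom b c) (f f' : bhom a b)
    (j : iso g g') (i : iso f f') : iso (g ∘ f) (g' ∘ f') :=
  {| fwd := j ⋆ i; bwd := bwd j ⋆ bwd i |}.
Next Obligation. by move=> *; rewrite -comp2M !bwdK comp2_1. Qed.
Next Obligation. by move=> *; rewrite -comp2M !fwdK comp2_1. Qed.

Lemma lwhisk_faithful a b (f f' : bhom a b) (s t : f ~> f') :
  bid b ◁ s = bid b ◁ t -> s = t.
Proof. by move=> e; apply: (iso_epi (i := lun f)); rewrite -!lun_nat e. Qed.

Lemma rwhisk_faithful a b (f f' : bhom a b) (s t : f ~> f') :
  s ▷ bid a = t ▷ bid a -> s = t.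
Proof. by move=> e; apply: (iso_epi (i := run f)); rewrite -!run_nat e. Qed.

Lemma lun_comp a b c (g : bhom b c) (f : bhom a b) :
  lun (g ∘ f) • asc (bid c) g f = lun g ▷ f.
Proof.
apply: lwhisk_faithful; rewrite comp2_lM.
apply: (iso_epi (i := asc (bid c) (bid c ∘ g) f)).
apply: (iso_epi (i := iso_comp2 (asc (bid c) (bid c) g) (iso_id f))) => /=.
rewrite -!cmpA (cmpA (bid c ◁ asc _ _ _)) pentagon.
rewrite (cmpA _ (asc _ _ _)) triangle.
rewrite (cmpA (bid c ◁ (lun g ▷ f))) -asc_nat -cmpA -comp2_rM triangle.
by rewrite -comp2_1 -asc_nat.
Qed.

End BicatTheory.

(* Coherence by reflection. A formal 1-cell e acts on 1-cells w into its source
   by nf e w, which is ev1 e ∘ w reassociated to the right with its identities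
   removed; a formal 2-cell c acts by sem c w, in which every associator and
   unitor has become an identity. By sem_inj an equation between 2-cells may be
   proved after this strictification, and by sem_eq a known one transported
   through it; the tactics strictify and strictify_in do both. *)
Section Coherence.
Variable B : bicat.

Inductive exp1 : B -> B -> Type :=
| EVar (a b : B) (f : bhom a b) : exp1 a b
| EId (a : B) : exp1 a a
| EComp (a b c : B) (g : exp1 b c) (f : exp1 a b) : exp1 a c.

Fixpoint ev1 (a b : B) (e : exp1 a b) : bhom a b :=
  match e with
  | EVar _ _ f => f
  | EId a => bid a
  | EComp _ _ _ g f => ev1 g ∘ ev1 f
  end.

Fixpoint nf (a b : B) (e : exp1 a b) (x : B) : bhom x a -> bhom x b :=
  match e with
  | EVar _ _ f => fun w => f ∘ w
  | EId _ => fun w => w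
  | EComp _ _ _ g f => fun w => nf g (nf f w)
  end.

Fixpoint nfm (a b : B) (e : exp1 a b) (x : B) :
    forall w w' : bhom x a, w ~> w' -> nf e w ~> nf e w' :=
  match e with
  | EVar _ _ f => fun w w' t => f ◁ t
  | EId _ => fun w w' t => t
  | EComp _ _ _ g f => fun w w' t => nfm g (nfm f t)
  end.

Fixpoint nfi (a b : B) (e : exp1 a b) (x : B) :
    forall w : bhom x a, iso (ev1 e ∘ w) (nf e w) :=
  match e with
  | EVar _ _ f => fun w => iso_id _
  | EId _ => fun w => lun w
  | EComp _ _ _ g f => fun w =>
      iso_cmp (nfi g (nf f w))
        (iso_cmp (iso_comp2 (iso_id (ev1 g)) (nfi f w))
                 (asc (ev1 g) (ev1 f) w))
  end.

Inductive exp2 : forall a b : B, exp1 a b -> exp1 a b -> Type :=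
| CVar (a b : B) (e e' : exp1 a b) (t : ev1 e ~> ev1 e') : exp2 e e'
| CId (a b : B) (e : exp1 a b) : exp2 e e
| CCmp (a b : B) (e e' e'' : exp1 a b) (s : exp2 e' e'') (t : exp2 e e') :
    exp2 e e''
| CComp2 (a b c : B) (g g' : exp1 b c) (f f' : exp1 a b)
    (s : exp2 g g') (t : exp2 f f') : exp2 (EComp g f) (EComp g' f')
| CAsc (a b c d : B) (h : exp1 c d) (g : exp1 b c) (f : exp1 a b) :
    exp2 (EComp (EComp h g) f) (EComp h (EComp g f))
| CAsc' (a b c d : B) (h : exp1 c d) (g : exp1 b c) (f : exp1 a b) :
    exp2 (EComp h (EComp g f)) (EComp (EComp h g) f)
| CLun (a b : B) (f : exp1 a b) : exp2 (EComp (EId b) f) f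
| CLun' (a b : B) (f : exp1 a b) : exp2 f (EComp (EId b) f)
| CRun (a b : B) (f : exp1 a b) : exp2 (EComp f (EId a)) f
| CRun' (a b : B) (f : exp1 a b) : exp2 f (EComp f (EId a)).

Fixpoint ev2 (a b : B) (e e' : exp1 a b) (c : exp2 e e') : ev1 e ~> ev1 e' :=
  match c with
  | CVar _ _ _ _ t => t
  | CId _ _ e => idc (ev1 e)
  | CCmp _ _ _ _ _ s t => ev2 s • ev2 t
  | CComp2 _ _ _ _ _ _ _ s t => ev2 s ⋆ ev2 t
  | CAsc _ _ _ _ h g f => asc (ev1 h) (ev1 g) (ev1 f)
  | CAsc' _ _ _ _ h g f => bwd (asc (ev1 h) (ev1 g) (ev1 f))
  | CLun _ _ f => lun (ev1 f)
  | CLun' _ _ f => bwd (lun (ev1 f))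
  | CRun _ _ f => run (ev1 f)
  | CRun' _ _ f => bwd (run (ev1 f))
  end.

Definition act (a b : B) (e e' : exp1 a b) (t : ev1 e ~> ev1 e')
    (x : B) (w : bhom x a) : nf e w ~> nf e' w :=
  locked (nfi e' w • (t ▷ w) • bwd (nfi e w)).

Fixpoint sem (a b : B) (e e' : exp1 a b) (c : exp2 e e') (x : B) :
    forall w : bhom x a, nf e w ~> nf e' w :=
  match c with
  | CVar _ _ _ _ t => fun w => act t w
  | CId _ _ e => fun w => idc (nf e w)
  | CCmp _ _ _ _ _ s t => fun w => sem s w • sem t w
  | CComp2 _ _ _ g g' f f' s t => fun w => sem s (nf f' w) • nfm g (sem t w)
  | CAsc _ _ _ _ h g f => fun w => idc _
  | CAsc' _ _ _ _ h g f => fun w => idc _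
  | CLun _ _ f => fun w => idc _
  | CLun' _ _ f => fun w => idc _
  | CRun _ _ f => fun w => idc _
  | CRun' _ _ f => fun w => idc _
  end.

Lemma nfm1 a b (e : exp1 a b) x (w : bhom x a) : nfm e (idc w) = idc (nf e w).
Proof.
elim: e x w => //= [a' b' f x w|a' b' c g IHg f IHf x w]; first exact: comp2_1.
by rewrite IHf IHg.
Qed.

Lemma nfmM a b (e : exp1 a b) x (w w' w'' : bhom x a)
  (s : w' ~> w'') (t : w ~> w') : nfm e (s • t) = nfm e s • nfm e t.
Proof.
elim: e x w w' w'' s t => //= [*|a' b' c g IHg f IHf x w w' w'' s t].
  exact: comp2_lM.
by rewrite IHf IHg.
Qed.

Lemma nfi_nat a b (e : exp1 a b) x (w w' : bhom x a) (t : w ~> w') :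
  nfi e w' • (ev1 e ◁ t) = nfm e t • nfi e w.
Proof.
elim: e x w w' t => /= [*|*|a' b' c g IHg f IHf x w w' t].
- by rewrite cmp1m cmpm1.
- exact: lun_nat.
- rewrite -!cmpA -(comp2_1 (ev1 g)) asc_nat !cmpA -IHg.
  congr (_ • _); rewrite -!cmpA; congr (_ • _).
  by rewrite -!comp2_lM IHf.
Qed.

Lemma act_nat a b (e e' : exp1 a b) (t : ev1 e ~> ev1 e') x (w w' : bhom x a)
  (u : w ~> w') : act t w' • nfm e u = nfm e' u • act t w.
Proof.
rewrite /act -!lock; apply: (iso_epi (i := nfi e w)).
rewrite -!cmpA -nfi_nat bwdK.
rewrite cmpm1 !cmpA -nfi_nat -!cmpA; congr (_ • _).
by rewrite (cmpA (bwd _)) bwdK cmp1m -comp2_lr -comp2_rl.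
Qed.

Lemma act_nat1 a b (f f' : bhom a b) (t : f ~> f') x (w w' : bhom x a)
    (u : w ~> w') :
  @act _ _ (EVar f) (EVar f') t _ w' • (f ◁ u) =
  (f' ◁ u) • @act _ _ (EVar f) (EVar f') t _ w.
Proof. exact: (@act_nat _ _ (EVar f) (EVar f')). Qed.

Lemma act_nat2 a b b' c (g : bhom b c) (f : bhom a b) (g' : bhom b' c)
    (f' : bhom a b') (t : g ∘ f ~> g' ∘ f') x (w w' : bhom x a) (u : w ~> w') :
  @act _ _ (EComp (EVar g) (EVar f)) (EComp (EVar g') (EVar f')) t _ w' •
    (g ◁ (f ◁ u)) =
  (g' ◁ (f' ◁ u)) •
    @act _ _ (EComp (EVar g) (EVar f)) (EComp (EVar g') (EVar f')) t _ w.
Proof.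
exact: (@act_nat _ _ (EComp (EVar g) (EVar f)) (EComp (EVar g') (EVar f'))).
Qed.

Lemma actM a b (e e' e'' : exp1 a b) (s : ev1 e' ~> ev1 e'')
  (t : ev1 e ~> ev1 e') x (w : bhom x a) : act (s • t) w = act s w • act t w.
Proof. by rewrite /act -!lock comp2_rM !cmpA bwdK_l. Qed.

Lemma act1 a b (e : exp1 a b) x (w : bhom x a) :
  act (idc (ev1 e)) w = idc (nf e w).
Proof. by rewrite /act -!lock comp2_1 cmpm1 fwdK. Qed.

Lemma act_fwdK a b (e e' : exp1 a b) (i : iso (ev1 e) (ev1 e')) x
  (w : bhom x a) : act i w • act (bwd i) w = idc _.
Proof. by rewrite -actM fwdK act1. Qed.

Lemma act_bwdK a b (e e' : exp1 a b) (i : iso (ev1 e) (ev1 e')) x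
  (w : bhom x a) : act (bwd i) w • act i w = idc _.
Proof. by rewrite -actM bwdK act1. Qed.

Lemma sem_bwd a b (e e' : exp1 a b) (i : iso (ev1 e) (ev1 e')) x
    (w : bhom x a) (n : nf e w ~> nf e' w) (n' : nf e' w ~> nf e w) :
  n' • n = idc _ ->
  nfi e' w • (i ▷ w) = n • nfi e w -> nfi e w • (bwd i ▷ w) = n' • nfi e' w.
Proof.
move=> n'n H; apply: (iso_epi (i := iso_comp2 i (iso_id w))) => /=.
rewrite -cmpA -comp2_rM bwdK comp2_1 cmpm1 -cmpA H.
by rewrite cmpA n'n cmp1m.
Qed.

Lemma sem_asc a b c d (h : exp1 c d) (g : exp1 b c) (f : exp1 a b) x
    (w : bhom x a) :
  nfi (EComp h (EComp g f)) w • (asc (ev1 h) (ev1 g) (ev1 f) ▷ w) =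
  nfi (EComp (EComp h g) f) w.
Proof.
rewrite /= !comp2_lM -!cmpA; congr (_ • (_ • _)).
rewrite !(cmpA (asc _ _ _)) -(comp2_1 (ev1 h) (ev1 g)) asc_nat -!cmpA.
by congr (_ • _); rewrite -pentagon !cmpA.
Qed.

Lemma sem_lun a b (f : exp1 a b) x (w : bhom x a) :
  nfi f w • (lun (ev1 f) ▷ w) = nfi (EComp (EId b) f) w.
Proof. by rewrite /= cmpA lun_nat -cmpA lun_comp. Qed.

Lemma sem_run a b (f : exp1 a b) x (w : bhom x a) :
  nfi f w • (run (ev1 f) ▷ w) = nfi (EComp f (EId a)) w.
Proof. by rewrite /= triangle. Qed.

Lemma semE a b (e e' : exp1 a b) (c : exp2 e e') x (w : bhom x a) :
  nfi e' w • (ev2 c ▷ w) = sem c w • nfi e w.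
Proof.
elim: c x w => /= {a b e e'}.
- by move=> a b e e' t x w; rewrite /act -lock bwdK_l.
- by move=> *; rewrite comp2_1 cmpm1 cmp1m.
- move=> a b e e' e'' s IHs t IHt x w.
  by rewrite comp2_rM cmpA IHs -cmpA IHt cmpA.
- move=> a b c g g' f f' s IHs t IHt x w.
  rewrite -!cmpA asc_nat (cmpA (_ ◁ _)) -comp2M cmp1m IHt.
  rewrite (comp2_lr (ev2 s)) comp2_lM !cmpA IHs.
  by rewrite -(cmpA (sem s _)) nfi_nat !cmpA.
- by move=> *; rewrite cmp1m; exact: sem_asc.
- move=> a b c d h g f x w.
  apply: (@sem_bwd _ _ (EComp (EComp h g) f) (EComp h (EComp g f))
    (asc (ev1 h) (ev1 g) (ev1 f)) x w (idc _) (idc _) (cmp1m _)).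
  by rewrite cmp1m; exact: sem_asc.
- by move=> *; rewrite cmp1m; exact: sem_lun.
- move=> a b f x w.
  apply: (@sem_bwd _ _ (EComp (EId b) f) f (lun (ev1 f)) x w
    (idc _) (idc _) (cmp1m _)).
  by rewrite cmp1m; exact: sem_lun.
- by move=> *; rewrite cmp1m; exact: sem_run.
- move=> a b f x w.
  apply: (@sem_bwd _ _ (EComp f (EId a)) f (run (ev1 f)) x w
    (idc _) (idc _) (cmp1m _)).
  by rewrite cmp1m; exact: sem_run.
Qed.

Lemma sem_inj a b (e e' : exp1 a b) (c c' : exp2 e e') :
  sem c (bid a) = sem c' (bid a) -> ev2 c = ev2 c'.
Proof.
move=> H; apply: rwhisk_faithful; apply: (iso_mono (i := nfi e' _)).
by rewrite !semE H.
Qed.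

Lemma sem_eq a b (e e' : exp1 a b) (c c' : exp2 e e') :
  ev2 c = ev2 c' -> forall x (w : bhom x a), sem c w = sem c' w.
Proof.
by move=> H x w; apply: (iso_epi (i := nfi e w)); rewrite -!semE H.
Qed.

End Coherence.


Arguments EVar {B a b} f.
Arguments EId {B} a.
Arguments EComp {B a b c} g f.
Arguments CVar {B a b} e e' t.
Arguments CId {B a b} e.
Arguments CCmp {B a b e e' e''} s t.
Arguments CComp2 {B a b c g g' f f'} s t.
Arguments CAsc {B a b c d} h g f.
Arguments CAsc' {B a b c d} h g f.
Arguments CLun {B a b} f.
Arguments CLun' {B a b} f.
Arguments CRun {B a b} f.
Arguments CRun' {B a b} f.
Arguments act {B a b} e e' t {x} w : simpl never.

Ltac reify1 f :=
  lazymatch f with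
  | ?g ∘ ?h =>
      let g' := reify1 g in let h' := reify1 h in constr:(EComp g' h')
  | @bid _ ?a => constr:(EId a)
  | _ => constr:(EVar f)
  end.

Ltac reify2 t :=
  lazymatch t with
  | ?s • ?u =>
      let s' := reify2 s in let u' := reify2 u in constr:(CCmp s' u')
  | idc ?f => let f' := reify1 f in constr:(CId f')
  | ?s ⋆ ?u =>
      let s' := reify2 s in let u' := reify2 u in constr:(CComp2 s' u')
  | fwd (asc ?h ?g ?f) =>
      let h' := reify1 h in let g' := reify1 g in let f' := reify1 f in
      constr:(CAsc h' g' f')
  | bwd (asc ?h ?g ?f) =>
      let h' := reify1 h in let g' := reify1 g in let f' := reify1 f in
      constr:(CAsc' h' g' f')
  | fwd (lun ?f) => let f' := reify1 f in constr:(CLun f')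
  | bwd (lun ?f) => let f' := reify1 f in constr:(CLun' f')
  | fwd (run ?f) => let f' := reify1 f in constr:(CRun f')
  | bwd (run ?f) => let f' := reify1 f in constr:(CRun' f')
  | _ =>
      lazymatch type of t with
      | mor ?f ?g =>
          let f' := reify1 f in let g' := reify1 g in constr:(CVar f' g' t)
      end
  end.

Definition strictE := (@cmp1m, @cmpm1, comp2_1, comp2_lM, @cmpA).

Ltac strictify :=
  lazymatch goal with
  | |- @eq (@mor (@bhom (bi_data ?B) ?a ?b) _ _) ?l ?r =>
      let c := reify2 l in let c' := reify2 r in
      change (ev2 c = ev2 c'); apply: (@sem_inj B a b _ _ c c');
      cbn [sem nf nfm]; rewrite ?strictE
  end.

Ltac strictify_in H w :=
  lazymatch type of H with
  | @eq (@mor (@bhom (bi_data ?B) ?a ?b) _ _) ?l ?r =>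
      let c := reify2 l in let c' := reify2 r in
      generalize (@sem_eq B a b _ _ c c' H _ w); clear H; move=> H;
      cbn [sem nf nfm] in H; rewrite ?strictE in H
  end.

Record psfunctor (A B : bicat) := PsFunctor {
  ps_ob :> A -> B;
  ps_hom : forall x y : A, functor (bhom x y) (bhom (ps_ob x) (ps_ob y));
  ps_id : forall x : A, iso (bid (ps_ob x)) (ps_hom x x (bid x));
  ps_comp : forall (x y z : A) (g : bhom y z) (f : bhom x y),
    iso (ps_hom y z g ∘ ps_hom x y f) (ps_hom x z (g ∘ f));
  ps_comp_nat : forall (x y z : A) (g g' : bhom y z) (f f' : bhom x y)
      (s : g ~> g') (t : f ~> f'),
    ps_comp g' f' • (fmap (ps_hom y z) s ⋆ fmap (ps_hom x y) t) =
    fmap (ps_hom x z) (s ⋆ t) • ps_comp g f;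
  ps_assoc : forall (x y z t : A)
      (h : bhom z t) (g : bhom y z) (f : bhom x y),
    fmap (ps_hom x t) (asc h g f) • ps_comp (h ∘ g) f •
      (ps_comp h g ▷ ps_hom x y f) =
    ps_comp h (g ∘ f) • (ps_hom z t h ◁ ps_comp g f) •
      asc (ps_hom z t h) (ps_hom y z g) (ps_hom x y f);
  ps_lunit : forall (x y : A) (f : bhom x y),
    fmap (ps_hom x y) (lun f) • ps_comp (bid y) f •
      (ps_id y ▷ ps_hom x y f) = lun (ps_hom x y f);
  ps_runit : forall (x y : A) (f : bhom x y),
    fmap (ps_hom x y) (run f) • ps_comp f (bid x) •
      (ps_hom x y f ◁ ps_id x) = run (ps_hom x y f) }.

Arguments ps_hom {A B} _ {x y}.
Arguments ps_id {A B} _ _.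
Arguments ps_comp {A B} _ {x y z} _ _.

Lemma ps_comp_nat_l (A B : bicat) (F : psfunctor A B) (x y z : A)
    (g g' : bhom y z) (f : bhom x y) (s : g ~> g') :
  ps_comp F g' f • (fmap (ps_hom F) s ▷ ps_hom F f) =
  fmap (ps_hom F) (s ▷ f) • ps_comp F g f.
Proof. by rewrite -ps_comp_nat fmap1. Qed.

Lemma ps_comp_nat_r (A B : bicat) (F : psfunctor A B) (x y z : A)
    (g : bhom y z) (f f' : bhom x y) (t : f ~> f') :
  ps_comp F g f' • (ps_hom F g ◁ fmap (ps_hom F) t) =
  fmap (ps_hom F) (g ◁ t) • ps_comp F g f.
Proof. by rewrite -ps_comp_nat fmap1. Qed.

Record strong_trans (A B : bicat) (F G : psfunctor A B) := StrongTrans {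
  st_ob :> forall x : A, bhom (F x) (G x);
  st_hom : forall (x y : A) (f : bhom x y),
    iso (ps_hom G f ∘ st_ob x) (st_ob y ∘ ps_hom F f);
  st_nat : forall (x y : A) (f f' : bhom x y) (t : f ~> f'),
    st_hom f' • (fmap (ps_hom G) t ▷ st_ob x) =
    (st_ob y ◁ fmap (ps_hom F) t) • st_hom f;
  st_id : forall x : A,
    st_hom (bid x) • (ps_id G x ▷ st_ob x) =
    (st_ob x ◁ ps_id F x) • bwd (run (st_ob x)) • lun (st_ob x);
  st_comp : forall (x y z : A) (g : bhom y z) (f : bhom x y),
    st_hom (g ∘ f) • (ps_comp G g f ▷ st_ob x) =
    (st_ob z ◁ ps_comp F g f) • asc (st_ob z) (ps_hom F g) (ps_hom F f) •
      (st_hom g ▷ ps_hom F f) •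
      bwd (asc (ps_hom G g) (st_ob y) (ps_hom F f)) •
      (ps_hom G g ◁ st_hom f) • asc (ps_hom G g) (ps_hom G f) (st_ob x) }.

Arguments st_hom {A B F G} _ {x y} _.

Record modification (A B : bicat) (F G : psfunctor A B)
    (s t : strong_trans F G) := Modification {
  mod_ob :> forall x : A, s x ~> t x;
  mod_nat : forall (x y : A) (f : bhom x y),
    st_hom t f • (ps_hom G f ◁ mod_ob x) =
    (mod_ob y ▷ ps_hom F f) • st_hom s f }.

Lemma mod_eq (A B : bicat) (F G : psfunctor A B) (s t : strong_trans F G)
  (m n : modification s t) : (forall x, m x = n x) -> m = n.
Proof.
case: m n => [m Hm] [n Hn] /= e.
have {}e : m = n by apply: functional_extensionality_dep.
by subst n; rewrite (Prop_irrelevance Hm Hn).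
Qed.

Section PseudofunctorBicat.
Variables A B : bicat.

Section HomCat.
Variables F G : psfunctor A B.

Program Definition mod_id (s : strong_trans F G) : modification s s :=
  {| mod_ob := fun x => idc (s x) |}.
Next Obligation. by move=> s x y f; rewrite !comp2_1 cmp1m cmpm1. Qed.

Program Definition mod_cmp (s t u : strong_trans F G)
    (n : modification t u) (m : modification s t) : modification s u :=
  {| mod_ob := fun x => n x • m x |}.
Next Obligation.
move=> s t u n m x y f.
by rewrite comp2_lM comp2_rM cmpA mod_nat -!cmpA mod_nat.
Qed.

Program Definition trans_cat : category :=
  {| cat_ob := strong_trans F G; mor := @modification A B F G;
     idc := mod_id; cmp := mod_cmp |}.
Next Obligation. by move=> *; apply: mod_eq => x; apply: cmp1m. Qed.
Next Obligation. by move=> *; apply: mod_eq => x; apply: cmpm1. Qed.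
Next Obligation. by move=> *; apply: mod_eq => x; apply: cmpA. Qed.

End HomCat.

Program Definition trans_id (F : psfunctor A B) : strong_trans F F :=
  {| st_ob := fun x => bid (F x);
     st_hom := fun x y f =>
       iso_cmp (iso_inv (lun (ps_hom F f))) (run (ps_hom F f)) |}.
Next Obligation. by move=> F x y f f' t; strictify. Qed.
Next Obligation. by move=> F x; strictify. Qed.
Next Obligation. by move=> F x y z g f; strictify. Qed.

Program Definition trans_comp (F G H : psfunctor A B)
    (t : strong_trans G H) (s : strong_trans F G) : strong_trans F H :=
  {| st_ob := fun x => t x ∘ s x;
     st_hom := fun x y f =>
       iso_cmp (iso_inv (asc (t y) (s y) (ps_hom F f)))
      (iso_cmp (iso_comp2 (iso_id (t y)) (st_hom s f))
      (iso_cmp (asc (t y) (ps_hom G f) (s x))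
      (iso_cmp (iso_comp2 (st_hom t f) (iso_id (s x)))
               (iso_inv (asc (ps_hom H f) (t x) (s x)))))) |}.
Next Obligation.
move=> F G H t s x y f f' u; strictify.
have Ht := st_nat t u; strictify_in Ht (s x ∘ bid (F x)).
have Hs := st_nat s u; strictify_in Hs (bid (F x)).
by rewrite -cmpA Ht cmpA -comp2_lM Hs comp2_lM.
Qed.
Next Obligation.
move=> F G H t s x; strictify.
have Ht := st_id t x; strictify_in Ht (s x ∘ bid (F x)).
have Hs := st_id s x; strictify_in Hs (bid (F x)).
by rewrite -cmpA Ht -comp2_lM Hs.
Qed.
Next Obligation.
move=> F G H t s x y z g f; strictify.
have Ht := st_comp t g f; strictify_in Ht (s x ∘ bid (F x)).
have Hs := st_comp s g f; strictify_in Hs (bid (F x)).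
rewrite -cmpA Ht !cmpA -comp2_lM Hs !comp2_lM; congr (_ • _).
by rewrite -!cmpA; congr (_ • (_ • _)); rewrite act_nat2.
Qed.

Program Definition mod_hcomp (F G H : psfunctor A B)
    (t t' : strong_trans G H) (s s' : strong_trans F G)
    (n : modification t t') (m : modification s s') :
    modification (trans_comp t s) (trans_comp t' s') :=
  {| mod_ob := fun x => n x ⋆ m x |}.
Next Obligation.
move=> F G H t t' s s' n m x y f; strictify.
have Ht := mod_nat n f; strictify_in Ht (s' x ∘ bid (F x)).
have Hs := mod_nat m f; strictify_in Hs (bid (F x)).
rewrite -(cmpA (t' y ◁ _)) Ht -!cmpA act_nat2.
rewrite !cmpA -(act_nat1 (n y)); congr (_ • _).
by rewrite -!cmpA -!comp2_lM Hs.
Qed.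

Program Definition trans_comp_functor (F G H : psfunctor A B) :
    functor (cat_prod (trans_cat G H) (trans_cat F G)) (trans_cat F H) :=
  {| fob := fun p => trans_comp p.1 p.2;
     fmap := fun p q u => mod_hcomp u.1 u.2 |}.
Next Obligation. by move=> *; apply: mod_eq => x; apply: comp2_1. Qed.
Next Obligation. by move=> *; apply: mod_eq => x; apply: comp2M. Qed.

Program Definition mod_iso (F G : psfunctor A B) (s t : strong_trans F G)
    (m : forall x, iso (s x) (t x))
    (m_nat : forall (x y : A) (f : bhom x y),
      st_hom t f • (ps_hom G f ◁ m x) = (m y ▷ ps_hom F f) • st_hom s f) :
    @iso (trans_cat F G) s t :=
  {| fwd := {| mod_ob := m; mod_nat := m_nat |};
     bwd := {| mod_ob := fun x => bwd (m x) |} |}.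
Next Obligation.
move=> F G s t m m_nat x y f.
apply: (iso_epi (i := iso_comp2 (iso_id _) (m x))) => /=.
rewrite -cmpA -comp2_lM bwdK comp2_1 cmpm1 -cmpA m_nat cmpA.
by rewrite -comp2_rM bwdK comp2_1 cmp1m.
Qed.
Next Obligation. by move=> *; apply: mod_eq => x; apply: bwdK. Qed.
Next Obligation. by move=> *; apply: mod_eq => x; apply: fwdK. Qed.

Program Definition trans_assoc (F G H K : psfunctor A B) :
    nat_iso (assoc_l (trans_comp_functor G H K) (trans_comp_functor F G K))
            (assoc_r (trans_comp_functor F G H) (trans_comp_functor F H K)) :=
  {| niso := fun p =>
       @mod_iso _ _ (trans_comp (trans_comp p.1.1 p.1.2) p.2)
         (trans_comp p.1.1 (trans_comp p.1.2 p.2))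
         (fun x => asc (p.1.1 x) (p.1.2 x) (p.2 x)) _ |}.
Next Obligation. by move=> F G H K [[r s] t] x y f /=; strictify. Qed.
Next Obligation.
by move=> F G H K p q [[r s] t]; apply: mod_eq => x; apply: asc_nat.
Qed.

Program Definition trans_lunit (F G : psfunctor A B) :
    nat_iso (functor_comp (trans_comp_functor F G G)
               (functor_pair
                  (functor_const (trans_id G : trans_cat G G)) functor_id))
            functor_id :=
  {| niso := fun s =>
       @mod_iso _ _ (trans_comp (trans_id G) s) s (fun x => lun (s x)) _ |}.
Next Obligation. by move=> F G s x y f /=; strictify. Qed.
Next Obligation. by move=> *; apply: mod_eq => x; apply: lun_nat. Qed.

Program Definition trans_runit (F G : psfunctor A B) :
    nat_iso (functor_comp (trans_comp_functor F F G)
               (functor_pair functor_id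
                  (functor_const (trans_id F : trans_cat F F))))
            functor_id :=
  {| niso := fun s =>
       @mod_iso _ _ (trans_comp s (trans_id F)) s (fun x => run (s x)) _ |}.
Next Obligation. by move=> F G s x y f /=; strictify. Qed.
Next Obligation. by move=> *; apply: mod_eq => x; apply: run_nat. Qed.

Program Definition psfunctor_bicat : bicat :=
  {| bi_data :=
       {| bi_ob := psfunctor A B; bhom := trans_cat; bid := trans_id;
          bcomp := trans_comp_functor; bassoc := trans_assoc;
          blunit := trans_lunit; brunit := trans_runit |} |}.
Next Obligation. by move=> *; apply: mod_eq => x; apply: pentagon. Qed.
Next Obligation. by move=> *; apply: mod_eq => x; apply: triangle. Qed.

End PseudofunctorBicat.

Program Definition ps_functor_id (A : bicat) : psfunctor A A :=
  {| ps_ob := fun x => x; ps_hom := fun x y => functor_id;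
     ps_id := fun x => iso_id (bid x);
     ps_comp := fun x y z g f => iso_id (g ∘ f) |}.
Next Obligation. by move=> *; rewrite cmpm1 cmp1m. Qed.
Next Obligation. by move=> *; rewrite !comp2_1 !cmpm1 cmp1m. Qed.
Next Obligation. by move=> *; rewrite !comp2_1 !cmpm1. Qed.
Next Obligation. by move=> *; rewrite !comp2_1 !cmpm1. Qed.

Program Definition ps_functor_comp (A B C : bicat) (G : psfunctor B C)
    (F : psfunctor A B) : psfunctor A C :=
  {| ps_ob := fun x => G (F x);
     ps_hom := fun x y => functor_comp (ps_hom G) (ps_hom F);
     ps_id := fun x => iso_cmp (iso_fmap (ps_hom G) (ps_id F x)) (ps_id G (F x));
     ps_comp := fun x y z g f =>
       iso_cmp (iso_fmap (ps_hom G) (ps_comp F g f))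
               (ps_comp G (ps_hom F g) (ps_hom F f)) |}.
Next Obligation.
by move=> *; rewrite -cmpA ps_comp_nat !cmpA -!fmapM ps_comp_nat.
Qed.
Next Obligation.
move=> A B C G F x y z t h g f; rewrite comp2_rM comp2_lM !cmpA.
rewrite -(cmpA _ _ (fmap _ _ ▷ _)) ps_comp_nat_l.
rewrite -(cmpA _ _ (_ ◁ fmap _ _)) ps_comp_nat_r.
rewrite !cmpA -!fmapM ps_assoc !fmapM -!cmpA; congr (_ • (_ • _)).
by rewrite !cmpA ps_assoc.
Qed.
Next Obligation.
move=> A B C G F x y f; rewrite comp2_rM !cmpA.
rewrite -(cmpA _ _ (fmap _ _ ▷ _)) ps_comp_nat_l.
by rewrite !cmpA -!fmapM ps_lunit ps_lunit.
Qed.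
Next Obligation.
move=> A B C G F x y f; rewrite comp2_lM !cmpA.
rewrite -(cmpA _ _ (_ ◁ fmap _ _)) ps_comp_nat_r.
by rewrite !cmpA -!fmapM ps_runit ps_runit.
Qed.

Section Biequivalence.
Variables A B : bicat.

(* Isomorphisms in a hom-category of psfunctor_bicat are the invertible
   modifications. *)
Definition quasi_inverse (F G : psfunctor_bicat A B)
    (s : bhom F G) (t : bhom G F) : Prop :=
  inhabited (iso (bid F) (t ∘ s)) /\ inhabited (iso (s ∘ t) (bid G)).

End Biequivalence.

Record biequivalence (A B : bicat) := Biequivalence {
  be_fun : psfunctor A B;
  be_inv : psfunctor B A;
  be_unit :
    strong_trans (ps_functor_id A) (ps_functor_comp be_inv be_fun);
  be_counit :
    strong_trans (ps_functor_comp be_fun be_inv) (ps_functor_id B);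
  be_unitP : exists be_unit' :
    strong_trans (ps_functor_comp be_inv be_fun) (ps_functor_id A),
    quasi_inverse (be_unit : @bhom (psfunctor_bicat A A) _ _) be_unit';
  be_counitP : exists be_counit' :
    strong_trans (ps_functor_id B) (ps_functor_comp be_fun be_inv),
    quasi_inverse (be_counit : @bhom (psfunctor_bicat B B) _ _) be_counit' }.

Definition biequivalent (A B : bicat) : Prop := inhabited (biequivalence A B).

Record groupoid := Groupoid {
  gpd_cat :> category;
  gpd_inv : forall (x y : gpd_cat) (f : x ~> y),
    exists g : y ~> x, g • f = idc x /\ f • g = idc y }.

(* u × 1 and 1 × u are precomposed with the canonical isomorphisms of G with
   * × G and G × *. *)
Record coherent_2group := Coherent2Group {
  tg :> groupoid;
  tg_mul : functor (cat_prod tg tg) tg;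
  tg_unit : functor cat_unit tg;
  tg_mul_equiv : is_equivalence (functor_pair functor_fst tg_mul);
  tg_assoc : nat_iso (assoc_l tg_mul tg_mul) (assoc_r tg_mul tg_mul);
  tg_lunit : nat_iso (functor_comp tg_mul
      (functor_pair (functor_comp tg_unit (functor_const (tt : cat_unit)))
         functor_id)) functor_id;
  tg_runit : nat_iso (functor_comp tg_mul
      (functor_pair functor_id
         (functor_comp tg_unit (functor_const (tt : cat_unit))))) functor_id;
  tg_pentagon : forall k h g f : tg,
    fmap tg_mul (x := (k, tg_mul (tg_mul (h, g), f)))
                (y := (k, tg_mul (h, tg_mul (g, f))))
      (idc k, fwd (tg_assoc ((h, g), f))) •
      tg_assoc ((k, tg_mul (h, g)), f) •
      fmap tg_mul (x := (tg_mul (tg_mul (k, h), g), f))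
                  (y := (tg_mul (k, tg_mul (h, g)), f))
        (fwd (tg_assoc ((k, h), g)), idc f) =
    tg_assoc ((k, h), tg_mul (g, f)) • tg_assoc ((tg_mul (k, h), g), f);
  tg_triangle : forall g f : tg,
    fmap tg_mul (x := (g, tg_mul (tg_unit tt, f))) (y := (g, f))
      (idc g, fwd (tg_lunit f)) • tg_assoc ((g, tg_unit tt), f) =
    fmap tg_mul (x := (tg_mul (g, tg_unit tt), f)) (y := (g, f))
      (fwd (tg_runit g), idc f) }.

Section Delooping.
Variable G : coherent_2group.

Program Definition deloop : bicat :=
  {| bi_data :=
       {| bi_ob := unit; bhom := fun _ _ => G; bid := fun _ => tg_unit G tt;
          bcomp := fun _ _ _ => tg_mul G;
          bassoc := fun _ _ _ _ => tg_assoc G;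
          blunit := fun _ _ => {| niso := tg_lunit G |};
          brunit := fun _ _ => {| niso := tg_runit G |} |} |}.
Next Obligation.
move=> _ _ x y f; rewrite -(nisoN (tg_lunit G)) /=; congr (_ • _).
by rewrite (fmap1 (tg_unit G) tt).
Qed.
Next Obligation.
move=> _ _ x y f; rewrite -(nisoN (tg_runit G)) /=; congr (_ • _).
by rewrite (fmap1 (tg_unit G) tt).
Qed.
Next Obligation. by move=> *; apply: tg_pentagon. Qed.
Next Obligation. by move=> *; apply: tg_triangle. Qed.

End Delooping.

Record nat_trans (C D : category) (F G : functor C D) := NatTrans {
  nt_ob :> forall x, F x ~> G x;
  ntN : forall x y (f : x ~> y), nt_ob y • fmap F f = fmap G f • nt_ob x }.

Lemma nt_eq (C D : category) (F G : functor C D) (s t : nat_trans F G) :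
  (forall x, s x = t x) -> s = t.
Proof.
case: s t => [s Hs] [t Ht] /= e.
have {}e : s = t by apply: functional_extensionality_dep.
by subst t; rewrite (Prop_irrelevance Hs Ht).
Qed.

Program Definition nt_id (C D : category) (F : functor C D) : nat_trans F F :=
  {| nt_ob := fun x => idc (F x) |}.
Next Obligation. by move=> *; rewrite cmp1m cmpm1. Qed.

Program Definition nt_cmp (C D : category) (F G H : functor C D)
    (t : nat_trans G H) (s : nat_trans F G) : nat_trans F H :=
  {| nt_ob := fun x => t x • s x |}.
Next Obligation. by move=> *; rewrite -cmpA ntN !cmpA ntN. Qed.

Program Definition nt_hcomp (C D E : category) (G G' : functor D E)
    (F F' : functor C D) (t : nat_trans G G') (s : nat_trans F F') :
    nat_trans (functor_comp G F) (functor_comp G' F') :=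
  {| nt_ob := fun x => t (F' x) • fmap G (s x) |}.
Next Obligation.
move=> C D E G G' F F' t s x y f.
by rewrite -cmpA -fmapM (ntN s) fmapM cmpA (ntN t) -cmpA.
Qed.

Section NatTransLaws.
Variables C D E E' : category.

Lemma nt_cmp1m (F G : functor C D) (s : nat_trans F G) :
  nt_cmp (nt_id G) s = s.
Proof. by apply: nt_eq => x; apply: cmp1m. Qed.

Lemma nt_cmpm1 (F G : functor C D) (s : nat_trans F G) :
  nt_cmp s (nt_id F) = s.
Proof. by apply: nt_eq => x; apply: cmpm1. Qed.

Lemma nt_hcomp1 (G : functor D E) (F : functor C D) :
  nt_hcomp (nt_id G) (nt_id F) = nt_id (functor_comp G F).
Proof. by apply: nt_eq => x /=; rewrite fmap1 cmp1m. Qed.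

Lemma nt_hcompM (G G' G'' : functor D E) (F F' F'' : functor C D)
    (t' : nat_trans G' G'') (t : nat_trans G G')
    (s' : nat_trans F' F'') (s : nat_trans F F') :
  nt_hcomp (nt_cmp t' t) (nt_cmp s' s) =
  nt_cmp (nt_hcomp t' s') (nt_hcomp t s).
Proof.
apply: nt_eq => x /=; rewrite fmapM -!cmpA; congr (_ • _).
by rewrite !cmpA ntN.
Qed.

(* Composition of functors is strictly associative and unital: the coherence
   cells below, and their inverses, have identity components. *)
Program Definition nt_assoc (H : functor E E') (G : functor D E)
    (F : functor C D) :
    nat_trans (functor_comp (functor_comp H G) F)
              (functor_comp H (functor_comp G F)) :=
  {| nt_ob := fun x => idc (H (G (F x))) |}.
Next Obligation. by move=> *; rewrite cmp1m cmpm1. Qed.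

Program Definition nt_assoc' (H : functor E E') (G : functor D E)
    (F : functor C D) :
    nat_trans (functor_comp H (functor_comp G F))
              (functor_comp (functor_comp H G) F) :=
  {| nt_ob := fun x => idc (H (G (F x))) |}.
Next Obligation. by move=> *; rewrite cmp1m cmpm1. Qed.

Program Definition nt_lunit (F : functor C D) :
    nat_trans (functor_comp functor_id F) F :=
  {| nt_ob := fun x => idc (F x) |}.
Next Obligation. by move=> *; rewrite cmp1m cmpm1. Qed.

Program Definition nt_lunit' (F : functor C D) :
    nat_trans F (functor_comp functor_id F) :=
  {| nt_ob := fun x => idc (F x) |}.
Next Obligation. by move=> *; rewrite cmp1m cmpm1. Qed.

Program Definition nt_runit (F : functor C D) :
    nat_trans (functor_comp F functor_id) F :=
  {| nt_ob := fun x => idc (F x) |}.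
Next Obligation. by move=> *; rewrite cmp1m cmpm1. Qed.

Program Definition nt_runit' (F : functor C D) :
    nat_trans F (functor_comp F functor_id) :=
  {| nt_ob := fun x => idc (F x) |}.
Next Obligation. by move=> *; rewrite cmp1m cmpm1. Qed.

Lemma nt_assocN (H H' : functor E E') (G G' : functor D E) (F F' : functor C D)
    (u : nat_trans H H') (t : nat_trans G G') (s : nat_trans F F') :
  nt_cmp (nt_assoc H' G' F') (nt_hcomp (nt_hcomp u t) s) =
  nt_cmp (nt_hcomp u (nt_hcomp t s)) (nt_assoc H G F).
Proof. by apply: nt_eq => x /=; rewrite cmp1m cmpm1 fmapM cmpA. Qed.

Lemma nt_lunitN (F F' : functor C D) (s : nat_trans F F') :
  nt_cmp (nt_lunit F') (nt_hcomp (nt_id functor_id) s) =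
  nt_cmp s (nt_lunit F).
Proof. by apply: nt_eq => x /=; rewrite !cmp1m cmpm1. Qed.

Lemma nt_runitN (F F' : functor C D) (s : nat_trans F F') :
  nt_cmp (nt_runit F') (nt_hcomp s (nt_id functor_id)) =
  nt_cmp s (nt_runit F).
Proof. by apply: nt_eq => x /=; rewrite fmap1 cmp1m. Qed.

End NatTransLaws.

Lemma nt_triangle (C D E : category) (G : functor D E) (F : functor C D) :
  nt_cmp (nt_hcomp (nt_id G) (nt_lunit F)) (nt_assoc G functor_id F) =
  nt_hcomp (nt_runit G) (nt_id F).
Proof. by apply: nt_eq => x /=; rewrite fmap1 !cmp1m. Qed.

Lemma nt_pentagon (C D E E' E'' : category) (K : functor E' E'') (H : functor E E')
    (G : functor D E) (F : functor C D) :
  nt_cmp (nt_cmp (nt_hcomp (nt_id K) (nt_assoc H G F))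
                 (nt_assoc K (functor_comp H G) F))
         (nt_hcomp (nt_assoc K H G) (nt_id F)) =
  nt_cmp (nt_assoc K H (functor_comp G F)) (nt_assoc (functor_comp K H) G F).
Proof. by apply: nt_eq => x /=; rewrite !fmap1 !cmp1m. Qed.

Section TwoVect.
Variable k : fieldType.

(* lmodType also carries a choice operator; functors and transformations ignore
   it, and it exists classically on every type. *)
Record prelinear_cat := PrelinearCat {
  pl_ob : Type;
  pl_hom : pl_ob -> pl_ob -> lmodType k;
  pl_id : forall x, pl_hom x x;
  pl_cmp : forall x y z, pl_hom y z -> pl_hom x y -> pl_hom x z;
  pl_cmp1m : forall x y (f : pl_hom x y), pl_cmp (pl_id y) f = f;
  pl_cmpm1 : forall x y (f : pl_hom x y), pl_cmp f (pl_id x) = f;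
  pl_cmpA : forall x y z t (h : pl_hom z t) (g : pl_hom y z) (f : pl_hom x y),
    pl_cmp h (pl_cmp g f) = pl_cmp (pl_cmp h g) f;
  pl_linear_l : forall x y z (f : pl_hom x y),
    linear (fun g : pl_hom y z => pl_cmp g f);
  pl_linear_r : forall x y z (g : pl_hom y z),
    linear (fun f : pl_hom x y => pl_cmp g f) }.

Definition pl_cat (X : prelinear_cat) : category :=
  {| cat_ob := pl_ob X; mor := @pl_hom X; idc := @pl_id X; cmp := @pl_cmp X;
     cmp1m := @pl_cmp1m X; cmpm1 := @pl_cmpm1 X; cmpA := @pl_cmpA X |}.

Record linear_functor (X Y : prelinear_cat) := LinearFunctor {
  lf_fun :> functor (pl_cat X) (pl_cat Y);
  lf_linear : forall x y : pl_ob X,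
    linear (fun f : pl_hom x y => fmap lf_fun f : pl_hom (lf_fun x) (lf_fun y)) }.

Program Definition linfun_id (X : prelinear_cat) : linear_functor X X :=
  {| lf_fun := functor_id |}.

Program Definition linfun_comp (X Y Z : prelinear_cat)
    (G : linear_functor Y Z) (F : linear_functor X Y) : linear_functor X Z :=
  {| lf_fun := functor_comp G F |}.
Next Obligation. by move=> X Y Z G F x y a u v; rewrite !lf_linear. Qed.

Program Definition linfun_cat (X Y : prelinear_cat) : category :=
  {| cat_ob := linear_functor X Y; mor := fun F G => nat_trans F G;
     idc := fun F => nt_id F; cmp := fun _ _ _ t s => nt_cmp t s |}.
Next Obligation. by move=> *; apply: nt_eq => x; apply: cmp1m. Qed.
Next Obligation. by move=> *; apply: nt_eq => x; apply: cmpm1. Qed.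
Next Obligation. by move=> *; apply: nt_eq => x; apply: cmpA. Qed.

Program Definition linfun_comp_functor (X Y Z : prelinear_cat) :
    functor (cat_prod (linfun_cat Y Z) (linfun_cat X Y)) (linfun_cat X Z) :=
  {| fob := fun p => linfun_comp p.1 p.2;
     fmap := fun p q u => nt_hcomp u.1 u.2 |}.
Next Obligation. by move=> *; apply: nt_hcomp1. Qed.
Next Obligation. by move=> *; apply: nt_hcompM. Qed.

Program Definition linfun_assoc (X Y Z T : prelinear_cat) :
    nat_iso (assoc_l (linfun_comp_functor Y Z T) (linfun_comp_functor X Y T))
            (assoc_r (linfun_comp_functor X Y Z) (linfun_comp_functor X Z T)) :=
  {| niso := fun p => {| fwd := nt_assoc p.1.1 p.1.2 p.2;
                         bwd := nt_assoc' p.1.1 p.1.2 p.2 |} |}.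
Next Obligation.
by move=> *; apply: nt_eq => x; apply: (@cmp1m (pl_cat _)).
Qed.
Next Obligation.
by move=> *; apply: nt_eq => x; apply: (@cmp1m (pl_cat _)).
Qed.
Next Obligation. by move=> *; apply: nt_assocN. Qed.

Program Definition linfun_lunit (X Y : prelinear_cat) :
    nat_iso (functor_comp (linfun_comp_functor X Y Y)
               (functor_pair
                  (functor_const (linfun_id Y : linfun_cat Y Y)) functor_id))
            functor_id :=
  {| niso := fun F : linear_functor X Y =>
       {| fwd := nt_lunit F; bwd := nt_lunit' F |} |}.
Next Obligation.
by move=> *; apply: nt_eq => x; apply: (@cmp1m (pl_cat _)).
Qed.
Next Obligation.
by move=> *; apply: nt_eq => x; apply: (@cmp1m (pl_cat _)).
Qed.
Next Obligation. by move=> *; apply: nt_lunitN. Qed.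

Program Definition linfun_runit (X Y : prelinear_cat) :
    nat_iso (functor_comp (linfun_comp_functor X X Y)
               (functor_pair functor_id
                  (functor_const (linfun_id X : linfun_cat X X))))
            functor_id :=
  {| niso := fun F : linear_functor X Y =>
       {| fwd := nt_runit F; bwd := nt_runit' F |} |}.
Next Obligation.
by move=> *; apply: nt_eq => x; apply: (@cmp1m (pl_cat _)).
Qed.
Next Obligation.
by move=> *; apply: nt_eq => x; apply: (@cmp1m (pl_cat _)).
Qed.
Next Obligation. by move=> *; apply: nt_runitN. Qed.

Program Definition two_vect : bicat :=
  {| bi_data :=
       {| bi_ob := prelinear_cat; bhom := linfun_cat; bid := linfun_id;
          bcomp := linfun_comp_functor; bassoc := linfun_assoc;
          blunit := linfun_lunit; brunit := linfun_runit |} |}.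
Next Obligation. by move=> *; apply: nt_pentagon. Qed.
Next Obligation. by move=> *; apply: nt_triangle. Qed.

End TwoVect.

Definition two_rep (k : fieldType) (G : coherent_2group) : bicat :=
  psfunctor_bicat (deloop G) (two_vect k).

(* Main.v *)
Require Import Defs.
From mathcomp Require Import all_boot all_algebra.

(** Nothing about 2-groups or linear categories enters: for every bicategory
C, a biequivalence of A and B induces one of the bicategories [A, C] and
[B, C] of pseudofunctors, and the theorem is the case where A and B are
deloopings and C is the 2-category of prelinear categories.

Composing with F : A -> B is a strict 2-functor F^* : [B, C] -> [A, C]
(precomp). Given a biequivalence (F, G, s, t), the pseudofunctors G^* and F^*
form the induced one, and it remains to see that a pseudonatural equivalence
s : id => GF yields a pseudonatural equivalence id => F^* G^* . Its component
at H : A -> C is the whiskering Hs, with components H(s_x) (lwhisk); its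
2-cell at a transformation u : H => K is the inverse of the modification
whose components are the 2-cells u_(s_x) : K(s_x) u_x ~ u_(GFx) H(s_x) of u
at the 1-cells s_x (lwhisk_nat). So every axiom for s becomes an axiom for
the pseudofunctor H, and the axioms in the variable H are those of u.

For the inverse, an invertible modification j : 1 ~ ts is carried to
1 ~ (Ht)(Hs) by H(j_x) and the coherence cells of H. That this is a
modification in x says that H preserves identities, composites and
2-cells (lwhisk_invN), and that it is one in H says that u is compatible
with identities, composites and 2-cells (lwhisk_inv_hom).

Two technical points shape the text. Composition of pseudofunctors is
associative and unital on 0-, 1- and 2-cells by computation, but not on
coherence cells, so Hs is needed both as a transformation from H id and as
one from H; the two share all their data (whisk_unit, whisk_counit). And
equations in a bicategory of pseudofunctors are equations between components,
a reduction done once for abstract pseudofunctors (pointwise_trans,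
pointwise_iso). *)

Set Implicit Arguments.
Unset Strict Implicit.
Unset Printing Implicit Defensive.

Local Open Scope cat_scope.
#[local] Obligation Tactic := simpl; try by [].

(** * Coherence cells of pseudofunctors and strong transformations *)

Lemma postcmp2 (K : category) (x y z t : K) (f : x ~> y) (g : y ~> z)
    (r : x ~> z) : g • f = r -> forall h : z ~> t, h • g • f = h • r.
Proof. by move=> <- h; rewrite cmpA. Qed.

Lemma postcmp3 (K : category) (w x y z t : K) (e : w ~> x) (f : x ~> y)
    (g : y ~> z) (r : w ~> z) :
  g • f • e = r -> forall h : z ~> t, h • g • f • e = h • r.
Proof. by move=> <- h; rewrite !cmpA. Qed.

Section PsFunctorTheory.
Variables (A B : bicat) (F : psfunctor A B).

Lemma fmap_fwdK (x y : A) (f g : bhom x y) (i : iso f g) :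
  fmap (ps_hom F) i • fmap (ps_hom F) (bwd i) = idc _.
Proof. exact: (fwdK (iso_fmap (ps_hom F) i)). Qed.

Lemma fmap_bwdK (x y : A) (f g : bhom x y) (i : iso f g) :
  fmap (ps_hom F) (bwd i) • fmap (ps_hom F) i = idc _.
Proof. exact: (bwdK (iso_fmap (ps_hom F) i)). Qed.

Lemma ps_comp_idr (x y : A) (f : bhom x y) :
  ps_comp F f (bid x) • (ps_hom F f ◁ ps_id F x) =
  fmap (ps_hom F) (bwd (run f)) • run (ps_hom F f).
Proof. by rewrite -ps_runit !cmpA fmap_bwdK cmp1m. Qed.

Lemma ps_comp_idl (x y : A) (f : bhom x y) :
  ps_comp F (bid y) f • (ps_id F y ▷ ps_hom F f) =
  fmap (ps_hom F) (bwd (lun f)) • lun (ps_hom F f).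
Proof. by rewrite -ps_lunit !cmpA fmap_bwdK cmp1m. Qed.

Lemma ps_comp_asc (x y z t : A) (h : bhom z t) (g : bhom y z) (f : bhom x y) :
  ps_comp F h (g ∘ f) • (ps_hom F h ◁ ps_comp F g f) =
  fmap (ps_hom F) (asc h g f) • ps_comp F (h ∘ g) f •
    (ps_comp F h g ▷ ps_hom F f) •
    bwd (asc (ps_hom F h) (ps_hom F g) (ps_hom F f)).
Proof. by rewrite ps_assoc fwdK_l. Qed.

Lemma ps_comp_asc' (x y z t : A) (h : bhom z t) (g : bhom y z) (f : bhom x y) :
  ps_comp F (h ∘ g) f • (ps_comp F h g ▷ ps_hom F f) =
  fmap (ps_hom F) (bwd (asc h g f)) • ps_comp F h (g ∘ f) •
    (ps_hom F h ◁ ps_comp F g f) •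
    asc (ps_hom F h) (ps_hom F g) (ps_hom F f).
Proof.
by rewrite -!cmpA (cmpA (ps_comp F h _)) -ps_assoc !cmpA fmap_bwdK cmp1m.
Qed.

End PsFunctorTheory.

(** The 2-cells of u, read backwards, satisfy the axioms of an oplax
transformation; this is the direction in which a transformation u acts on the
whiskerings Hs. *)
Section StrongTransTheory.
Variables (A B : bicat) (H K : psfunctor A B) (u : strong_trans H K).

Lemma st_hom_comp (x y z : A) (g : bhom y z) (f : bhom x y) :
  fwd (st_hom u (g ∘ f)) =
    (u z ◁ ps_comp H g f) • asc (u z) (ps_hom H g) (ps_hom H f) •
      (st_hom u g ▷ ps_hom H f) •
      bwd (asc (ps_hom K g) (u y) (ps_hom H f)) •
      (ps_hom K g ◁ st_hom u f) • asc (ps_hom K g) (ps_hom K f) (u x) •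
      (bwd (ps_comp K g f) ▷ u x).
Proof.
apply: (iso_epi (i := iso_comp2 (ps_comp K g f) (iso_id (u x)))) => /=.
by rewrite st_comp -[RHS]cmpA -comp2_rM bwdK comp2_1 cmpm1.
Qed.

Lemma st_inv_nat (x y : A) (f f' : bhom x y) (m : f ~> f') :
  bwd (st_hom u f') • (u y ◁ fmap (ps_hom H) m) =
  (fmap (ps_hom K) m ▷ u x) • bwd (st_hom u f).
Proof.
apply: (iso_epi (i := st_hom u f)); rewrite bwdK_l -cmpA -st_nat.
by rewrite cmpA bwdK cmp1m.
Qed.

Lemma st_inv_id (x : A) :
  bwd (st_hom u (bid x)) • (u x ◁ ps_id H x) =
  (ps_id K x ▷ u x) • bwd (lun (u x)) • run (u x).
Proof.
apply: (iso_mono (i := st_hom u (bid x))); rewrite !cmpA fwdK cmp1m.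
by rewrite st_id fwdK_l bwdK_l.
Qed.

Lemma st_inv_comp (x y z : A) (g : bhom y z) (f : bhom x y) :
  bwd (st_hom u (g ∘ f)) • (u z ◁ ps_comp H g f) =
  (ps_comp K g f ▷ u x) • bwd (asc (ps_hom K g) (ps_hom K f) (u x)) •
    (ps_hom K g ◁ bwd (st_hom u f)) • asc (ps_hom K g) (u y) (ps_hom H f) •
    (bwd (st_hom u g) ▷ ps_hom H f) • bwd (asc (u z) (ps_hom H g) (ps_hom H f)).
Proof.
apply: (iso_mono (i := st_hom u (g ∘ f))); rewrite !cmpA fwdK cmp1m.
rewrite st_comp fwdK_l.
rewrite -(cmpA _ (_ ◁ _) (_ ◁ bwd _)) -comp2_lM fwdK comp2_1 cmpm1 bwdK_l.
by rewrite -(cmpA _ (_ ▷ _) (bwd _ ▷ _)) -comp2_rM fwdK comp2_1 cmpm1 fwdK_l.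
Qed.

Lemma mod_inv_nat (v : strong_trans H K) (m : modification u v) (x y : A)
    (f : bhom x y) :
  bwd (st_hom v f) • (m y ▷ ps_hom H f) =
  (ps_hom K f ◁ m x) • bwd (st_hom u f).
Proof.
apply: (iso_epi (i := st_hom u f)); rewrite bwdK_l -cmpA -mod_nat.
by rewrite cmpA bwdK cmp1m.
Qed.

Program Definition iso_mod (v : strong_trans H K)
    (m : @iso (trans_cat H K) u v) (x : A) : iso (u x) (v x) :=
  {| fwd := fwd m x; bwd := bwd m x |}.
Next Obligation.
move=> v m x; rewrite -[RHS]/(mod_id u x).
by rewrite -[mod_id u]/(idc (u : trans_cat H K)) -(bwdK m).
Qed.
Next Obligation.
move=> v m x; rewrite -[RHS]/(mod_id v x).
by rewrite -[mod_id v]/(idc (v : trans_cat H K)) -(fwdK m).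
Qed.

End StrongTransTheory.

(** * Precomposition with a pseudofunctor *)

Section Precomposition.
Variables (A B C : bicat) (F : psfunctor A B).

Program Definition rwhisk (H K : psfunctor B C) (u : strong_trans H K) :
    strong_trans (ps_functor_comp H F) (ps_functor_comp K F) :=
  {| st_ob := fun x => u (F x);
     st_hom := fun x y f => st_hom u (ps_hom F f) |}.
Next Obligation. by move=> H K u x y f f' t; apply: st_nat. Qed.
Next Obligation.
move=> H K u x; rewrite comp2_rM comp2_lM cmpA st_nat -!cmpA; congr (_ • _).
by rewrite st_id cmpA.
Qed.
Next Obligation.
move=> H K u x y z g f.
by rewrite comp2_rM comp2_lM cmpA st_nat -!cmpA st_comp -!cmpA.
Qed.

Program Definition mod_rwhisk (H K : psfunctor B C) (u v : strong_trans H K)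
    (m : modification u v) : modification (rwhisk u) (rwhisk v) :=
  {| mod_ob := fun x => m (F x) |}.
Next Obligation. by move=> H K u v m x y f; apply: mod_nat. Qed.

Program Definition rwhisk_functor (H K : psfunctor B C) :
    functor (trans_cat H K)
            (trans_cat (ps_functor_comp H F) (ps_functor_comp K F)) :=
  {| fob := @rwhisk H K; fmap := @mod_rwhisk H K |}.
Next Obligation. by move=> *; apply: mod_eq. Qed.
Next Obligation. by move=> *; apply: mod_eq. Qed.

(** The coherence cells have identity components because whiskering on the
right only reindexes the components of transformations. *)
Program Definition precomp :
    psfunctor (psfunctor_bicat B C) (psfunctor_bicat A C) :=
  {| ps_ob := fun H : psfunctor B C =>
       ps_functor_comp H F : psfunctor_bicat A C;
     ps_hom := fun H K => rwhisk_functor H K;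
     ps_id := fun H => mod_iso (s := trans_id (ps_functor_comp H F))
       (t := rwhisk (trans_id H)) (m := fun x => iso_id (bid (H (F x)))) _;
     ps_comp := fun H K L v u =>
       mod_iso (s := trans_comp (rwhisk v) (rwhisk u))
         (t := rwhisk (trans_comp v u))
         (m := fun x => iso_id (v (F x) ∘ u (F x))) _ |}.
Next Obligation. by move=> H x y f; rewrite !comp2_1 cmpm1 cmp1m. Qed.
Next Obligation. by move=> H K L v u x y f; rewrite !comp2_1 cmpm1 cmp1m. Qed.
Next Obligation.
by move=> *; apply: mod_eq => x /=; rewrite cmp1m cmpm1.
Qed.
Next Obligation.
move=> *; apply: mod_eq => x; apply: etrans (_ : _ = fwd (asc _ _ _)) _ => /=.
  by rewrite comp2_1 !cmpm1.
by rewrite comp2_1 !cmp1m.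
Qed.
Next Obligation.
by move=> *; apply: mod_eq => x /=; rewrite comp2_1 !cmpm1.
Qed.
Next Obligation.
by move=> *; apply: mod_eq => x /=; rewrite comp2_1 !cmpm1.
Qed.

End Precomposition.

(** * Postcomposition with a pseudofunctor *)

Section Lwhisk.
Variables (A B C : bicat) (H : psfunctor B C).

(** Each axiom is the image under H of the axiom for s. In the proofs the
coherence cells of H are moved to the right past the images of 2-cells by
naturality, and reassociated there. *)
Program Definition lwhisk (F F' : psfunctor A B) (s : strong_trans F F') :
    strong_trans (ps_functor_comp H F) (ps_functor_comp H F') :=
  {| st_ob := fun x => ps_hom H (s x);
     st_hom := fun x y f =>
       iso_cmp (iso_inv (ps_comp H (s y) (ps_hom F f)))
         (iso_cmp (iso_fmap (ps_hom H) (st_hom s f))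
                  (ps_comp H (ps_hom F' f) (s x))) |}.
Next Obligation.
move=> F F' s x y f f' t; apply: (iso_mono (i := ps_comp H _ _)).
rewrite -!cmpA ps_comp_nat_l !cmpA fwdK cmp1m -fmapM st_nat fmapM.
by rewrite ps_comp_nat_r fwdK_l.
Qed.
Next Obligation.
move=> F F' s x; apply: (iso_mono (i := ps_comp H _ _)).
rewrite !cmpA fwdK cmp1m comp2_rM comp2_lM !cmpA.
rewrite -(cmpA _ _ (fmap _ _ ▷ _)) ps_comp_nat_l ps_comp_nat_r.
rewrite -!cmpA ps_comp_idl !cmpA -!fmapM st_id.
rewrite -(cmpA _ (ps_comp _ _ _) (_ ◁ _)).
rewrite ps_comp_idr !fmapM !cmpA fwdK_l.
by rewrite -(cmpA _ (fmap _ (lun _))) fmap_fwdK cmpm1.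
Qed.
Next Obligation.
move=> F F' s x y z g f; apply: (iso_mono (i := ps_comp H _ _)).
rewrite !cmpA fwdK cmp1m !comp2_rM !comp2_lM !cmpA.
rewrite -(cmpA _ _ (fmap _ _ ▷ _)) ps_comp_nat_l !cmpA -fmapM st_comp.
rewrite ps_comp_nat_r -(cmpA _ (ps_comp H (s z) _) (_ ◁ ps_comp _ _ _)).
rewrite (ps_comp_asc H (s z)) !cmpA bwdK_l.
rewrite -(cmpA _ (_ ▷ _) (bwd _ ▷ _)) -comp2_rM fwdK comp2_1 cmpm1.
rewrite -(cmpA _ (ps_comp H _ _) (fmap _ _ ▷ _)) ps_comp_nat_l !cmpA.
rewrite -(cmpA _ _ (ps_comp H _ (s y) ▷ _)) (ps_comp_asc' H _ (s y)).
rewrite !cmpA fwdK_l.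
rewrite -(cmpA _ (_ ◁ _) (_ ◁ bwd _)) -comp2_lM fwdK comp2_1 cmpm1.
rewrite -(cmpA _ (ps_comp H _ _) (_ ◁ fmap _ _)) ps_comp_nat_r !cmpA.
rewrite -(cmpA _ (ps_comp H _ _) (_ ◁ _)) ps_comp_asc !cmpA bwdK_l.
by rewrite !fmapM.
Qed.

Program Definition mod_lwhisk (F F' : psfunctor A B) (s t : strong_trans F F')
    (m : modification s t) : modification (lwhisk s) (lwhisk t) :=
  {| mod_ob := fun x => fmap (ps_hom H) (m x) |}.
Next Obligation.
move=> F F' s t m x y f; rewrite -!cmpA ps_comp_nat_r (cmpA (fmap _ _)) -fmapM.
rewrite mod_nat fmapM !cmpA; do 2 congr (_ • _).
apply: (iso_epi (i := ps_comp H _ _)); rewrite bwdK_l.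
by rewrite -cmpA -ps_comp_nat_l cmpA bwdK cmp1m.
Qed.

Program Definition lwhisk_id (F : psfunctor A B) :
    modification (trans_id (ps_functor_comp H F)) (lwhisk (trans_id F)) :=
  {| mod_ob := fun x => ps_id H (F x) |}.
Next Obligation.
move=> F x y f; apply: (iso_mono (i := ps_comp H _ _)).
rewrite !cmpA fwdK cmp1m -cmpA ps_comp_idr ps_comp_idl fmapM.
by rewrite fwdK_l -!cmpA (cmpA (fmap _ _) (fmap _ (bwd _))) fmap_fwdK cmp1m.
Qed.

Program Definition lwhisk_comp (F F' F'' : psfunctor A B)
    (t : strong_trans F' F'') (s : strong_trans F F') :
    @iso (trans_cat _ _) (trans_comp (lwhisk t) (lwhisk s))
         (lwhisk (trans_comp t s)) :=
  mod_iso (s := trans_comp (lwhisk t) (lwhisk s))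
    (t := lwhisk (trans_comp t s)) (m := fun x => ps_comp H (t x) (s x)) _.
Next Obligation.
move=> F F' F'' t s x y f; apply: (iso_mono (i := ps_comp H _ _)).
rewrite !comp2_rM !comp2_lM !cmpA fwdK cmp1m.
rewrite -(cmpA _ _ (_ ◁ ps_comp _ _ (s x))) (ps_comp_asc H _ (t x) (s x)).
rewrite (ps_comp_asc' H (t y)) !cmpA fwdK_l.
rewrite -(cmpA _ (_ ◁ _) (_ ◁ bwd _)) -comp2_lM fwdK comp2_1 cmpm1.
rewrite -(cmpA _ _ (_ ◁ fmap _ _)) ps_comp_nat_r !cmpA.
rewrite -(cmpA _ _ (_ ◁ ps_comp _ _ _)) ps_comp_asc !cmpA bwdK_l.
rewrite -(cmpA _ (_ ▷ _) (bwd _ ▷ _)) -comp2_rM fwdK comp2_1 cmpm1.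
rewrite -(cmpA _ _ (fmap _ _ ▷ _)) ps_comp_nat_l !fmapM !cmpA.
by rewrite -(cmpA _ (fmap _ (bwd _)) (fmap _ _)) fmap_bwdK cmpm1.
Qed.

End Lwhisk.

(** The interchange of Ks, uF with uF', Hs, by the 2-cells of u at the 1-cells
s x. Up to coherence cells of H and K, both sides involve the 2-cell of u at a
composite: at F' f ∘ s x on the left and at s y ∘ F f on the right. They agree
because u is natural in the 2-cell of s at f between these two composites. *)
Lemma lwhisk_nat (A B C : bicat) (F F' : psfunctor A B) (s : strong_trans F F')
    (H K : psfunctor B C) (u : strong_trans H K) (x y : A) (f : bhom x y) :
  st_hom (trans_comp (rwhisk F' u) (lwhisk H s)) f •
    (ps_hom K (ps_hom F' f) ◁ st_hom u (s x)) =
  (st_hom u (s y) ▷ ps_hom H (ps_hom F f)) •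
    st_hom (trans_comp (lwhisk K s) (rwhisk F u)) f.
Proof.
rewrite /=; strictify.
have H1 := st_comp u (ps_hom F' f) (s x).
have H2 := st_hom_comp u (s y) (ps_hom F f).
have H3 := st_nat u (st_hom s f).
have HK := bwdK (ps_comp H (s y) (ps_hom F f)).
strictify_in H1 (bid (H (F x))).
strictify_in H2 (bid (H (F x))).
strictify_in H3 (bid (H (F x))).
strictify_in HK (bid (H (F x))).
rewrite (postcmp3 (esym H1)) cmpA (postcmp2 (esym H3)) H2.
by rewrite !cmpA -comp2_lM HK comp2_1 cmp1m.
Qed.

Section LwhiskInverse.
Variables (A B C : bicat) (F F' : psfunctor A B).
Variables (s : strong_trans F F') (t : strong_trans F' F).
Variable j : @iso (trans_cat F F) (trans_id F) (trans_comp t s).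

Definition lwhisk_inv (H : psfunctor B C) (x : A) :
    iso (bid (H (F x))) (ps_hom H (t x) ∘ ps_hom H (s x)) :=
  iso_cmp (iso_inv (ps_comp H (t x) (s x)))
    (iso_cmp (iso_fmap (ps_hom H) (iso_mod j x)) (ps_id H (F x))).

(** These isomorphisms are the components of 1 -> H1 -> H(ts) -> (Ht)(Hs),
a composite of modifications. *)
Lemma lwhisk_invN (H : psfunctor B C) (x y : A) (f : bhom x y) :
  st_hom (trans_comp (lwhisk H t) (lwhisk H s)) f •
    (ps_hom H (ps_hom F f) ◁ lwhisk_inv H x) =
  (lwhisk_inv H y ▷ ps_hom H (ps_hom F f)) •
    st_hom (trans_id (ps_functor_comp H F)) f.
Proof.
exact: (mod_nat (mod_cmp (bwd (lwhisk_comp H t s))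
  (mod_cmp (mod_lwhisk H (fwd j)) (lwhisk_id H F))) f).
Qed.

(** The three factors of lwhisk_inv are carried from H to K by the
compatibility of u with composites, with the 2-cell j x and with identities.
The left factor is the 2-cell at u of the composite of the transformations
that Hs and Ht form as H varies. *)
Lemma lwhisk_inv_hom (H K : psfunctor B C) (u : strong_trans H K) (x : A) :
  bwd (asc (ps_hom K (t x)) (ps_hom K (s x)) (u (F x))) •
    ((ps_hom K (t x) ◁ bwd (st_hom u (s x))) •
    (asc (ps_hom K (t x)) (u (F' x)) (ps_hom H (s x)) •
    ((bwd (st_hom u (t x)) ▷ ps_hom H (s x)) •
    bwd (asc (u (F x)) (ps_hom H (t x)) (ps_hom H (s x)))))) •
    (u (F x) ◁ lwhisk_inv H x) =
  (lwhisk_inv K x ▷ u (F x)) • (bwd (lun (u (F x))) • run (u (F x))).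
Proof.
apply: (iso_mono (i := iso_comp2 (ps_comp K (t x) (s x)) (iso_id _))) => /=.
rewrite !cmpA -st_inv_comp -comp2_rM !cmpA fwdK cmp1m.
rewrite -(cmpA _ (_ ◁ _)) -comp2_lM !cmpA fwdK cmp1m.
rewrite comp2_lM comp2_rM cmpA st_inv_nat.
by rewrite -(cmpA _ _ (_ ◁ _)) st_inv_id !cmpA.
Qed.

End LwhiskInverse.

(** * Pointwise description of transformations into [A, C] *)

(** The 1- and 2-cells of psfunctor_bicat A C are transformations and
modifications only after unfolding. The casts hom_trans, ob_trans, mod_at and
st_at fix that reading, so that components can be taken for abstract
pseudofunctors P and Q, where there is little to unfold. *)
Section Casts.
Variables X A C : bicat.

Definition mod_at (F G : psfunctor A C) (s t : strong_trans F G)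
    (m : @mor (trans_cat F G) s t) : forall x, s x ~> t x := mod_ob m.

Definition hom_trans (P : psfunctor X (psfunctor_bicat A C)) (H K : X)
    (u : bhom H K) : strong_trans (P H) (P K) := ps_hom P u.

Definition ob_trans (P Q : psfunctor X (psfunctor_bicat A C))
    (s : strong_trans P Q) (H : X) : strong_trans (P H) (Q H) := s H.

Definition st_at (P Q : psfunctor X (psfunctor_bicat A C))
    (s : strong_trans P Q) (H K : X) (u : bhom H K) (x : A) :
    hom_trans Q u x ∘ ob_trans s H x ~> ob_trans s K x ∘ hom_trans P u x :=
  mod_at (st_hom s u) x.

Lemma st_at_id (P : psfunctor X (psfunctor_bicat A C)) (H K : X)
    (u : bhom H K) (x : A) :
  st_at (trans_id P) u x = bwd (lun (hom_trans P u x)) • run (hom_trans P u x).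
Proof. by []. Qed.

Lemma st_at_comp (P Q R : psfunctor X (psfunctor_bicat A C))
    (t : strong_trans Q R) (s : strong_trans P Q) (H K : X) (u : bhom H K)
    (x : A) :
  st_at (trans_comp t s) u x =
    bwd (asc (ob_trans t K x) (ob_trans s K x) (hom_trans P u x)) •
    ((ob_trans t K x ◁ st_at s u x) •
    (asc (ob_trans t K x) (hom_trans Q u x) (ob_trans s H x) •
    ((st_at t u x ▷ ob_trans s H x) •
     bwd (asc (hom_trans R u x) (ob_trans t H x) (ob_trans s H x))))).
Proof. by []. Qed.

End Casts.

Section PointwiseTrans.
Variables (X A C : bicat) (P Q : psfunctor X (psfunctor_bicat A C)).
Variable c : forall H : X, strong_trans (P H) (Q H).
(* The 2-cells point in the oplax direction, in which they come for Hs. *)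
Variable h : forall (H K : X) (u : bhom H K) (x : A),
  iso (c K x ∘ hom_trans P u x) (hom_trans Q u x ∘ c H x).
Hypothesis h_mod : forall (H K : X) (u : bhom H K) (x y : A) (f : bhom x y),
  st_hom (trans_comp (hom_trans Q u) (c H)) f • (ps_hom (Q K) f ◁ h u x) =
  (h u y ▷ ps_hom (P H) f) • st_hom (trans_comp (c K) (hom_trans P u)) f.
Hypothesis h_nat : forall (H K : X) (u v : bhom H K) (m : u ~> v) (x : A),
  bwd (h v x) • (mod_at (fmap (ps_hom Q) m) x ▷ c H x) =
  (c K x ◁ mod_at (fmap (ps_hom P) m) x) • bwd (h u x).
Hypothesis h_id : forall (H : X) (x : A),
  bwd (h (bid H) x) • (mod_at (ps_id Q H) x ▷ c H x) =
  (c H x ◁ mod_at (ps_id P H) x) • bwd (run (c H x)) • lun (c H x).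
Hypothesis h_comp :
  forall (H K L : X) (v : bhom K L) (u : bhom H K) (x : A),
  bwd (h (v ∘ u) x) • (mod_at (ps_comp Q v u) x ▷ c H x) =
  (c L x ◁ mod_at (ps_comp P v u) x) •
    asc (c L x) (hom_trans P v x) (hom_trans P u x) •
    (bwd (h v x) ▷ hom_trans P u x) •
    bwd (asc (hom_trans Q v x) (c K x) (hom_trans P u x)) •
    (hom_trans Q v x ◁ bwd (h u x)) •
    asc (hom_trans Q v x) (hom_trans Q u x) (c H x).

Program Definition pointwise_trans : strong_trans P Q :=
  {| st_ob := c;
     st_hom := fun H K u => iso_inv (mod_iso
       (s := trans_comp (c K) (hom_trans P u))
       (t := trans_comp (hom_trans Q u) (c H)) (m := h u) (h_mod u)) |}.
Next Obligation. by move=> H K u v m; apply: mod_eq => x; apply: h_nat. Qed.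
Next Obligation. by move=> H; apply: mod_eq => x; apply: h_id. Qed.
Next Obligation. by move=> H K L v u; apply: mod_eq => x; apply: h_comp. Qed.

End PointwiseTrans.

Section PointwiseIso.
Variables (X A C : bicat) (P Q : psfunctor X (psfunctor_bicat A C)).
Variables s t : strong_trans P Q.
Variable m : forall (H : X) (x : A), iso (ob_trans s H x) (ob_trans t H x).
Hypothesis m_mod : forall (H : X) (x y : A) (f : bhom x y),
  st_hom (ob_trans t H) f • (ps_hom (Q H) f ◁ m H x) =
  (m H y ▷ ps_hom (P H) f) • st_hom (ob_trans s H) f.
Hypothesis m_nat : forall (H K : X) (u : bhom H K) (x : A),
  st_at t u x • (hom_trans Q u x ◁ m H x) =
  (m K x ▷ hom_trans P u x) • st_at s u x.

Program Definition pointwise_iso : @iso (trans_cat P Q) s t :=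
  mod_iso (s := s) (t := t) (m := fun H =>
    mod_iso (s := ob_trans s H) (t := ob_trans t H) (m := m H) (@m_mod H)) _.
Next Obligation. by move=> H K u; apply: mod_eq => x; apply: m_nat. Qed.

End PointwiseIso.

(** * Precomposition with a pseudonatural equivalence *)

Section PrecompEquivalence.
Variables (A B C : bicat) (F : psfunctor A B) (G : psfunctor B A).

Section Unit.
Variable s : strong_trans (ps_functor_id A) (ps_functor_comp G F).

(** The data of lwhisk H s, with H for H id and (HG)F for H(GF): the identity
and composition cells of these differ by functoriality of H on 2-cells. *)
Program Definition whisk_unit (H : psfunctor A C) :
    strong_trans H (ps_functor_comp (ps_functor_comp H G) F) :=
  {| st_ob := lwhisk H s;
     st_hom := fun x y f => st_hom (lwhisk H s) f |}.
Next Obligation. by move=> H x y f f' m; apply: (st_nat (lwhisk H s)). Qed.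
Next Obligation.
move=> H x; have := st_id (lwhisk H s) x.
by rewrite /= fmap1 cmp1m fmapM !cmpA.
Qed.
Next Obligation.
move=> H x y z g f; have := st_comp (lwhisk H s) g f.
by rewrite /= fmap1 cmp1m fmapM -(cmpA (fmap _ _)).
Qed.

Definition precomp_unit :
  strong_trans (ps_functor_id (psfunctor_bicat A C))
               (ps_functor_comp (precomp C F) (precomp C G)).
Proof.
apply: (@pointwise_trans _ _ _ (ps_functor_id (psfunctor_bicat A C))
  (ps_functor_comp (precomp C F) (precomp C G)) whisk_unit
  (fun H K u x => st_hom (u : strong_trans H K) (s x))).
- by move=> H K u x y f; have := lwhisk_nat s u f; rewrite /=.
- by move=> H K u v m x; apply: mod_inv_nat.
- by move=> H x; rewrite /= cmp1m !comp2_1 cmpm1 cmp1m.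
- by move=> H K L v u x; rewrite /= cmp1m !comp2_1 cmpm1 cmp1m.
Defined.

End Unit.

Section Counit.
Variable t : strong_trans (ps_functor_comp G F) (ps_functor_id A).

Program Definition whisk_counit (H : psfunctor A C) :
    strong_trans (ps_functor_comp (ps_functor_comp H G) F) H :=
  {| st_ob := lwhisk H t;
     st_hom := fun x y f => st_hom (lwhisk H t) f |}.
Next Obligation. by move=> H x y f f' m; apply: (st_nat (lwhisk H t)). Qed.
Next Obligation.
move=> H x; have := st_id (lwhisk H t) x.
by rewrite /= fmap1 cmp1m fmapM !cmpA.
Qed.
Next Obligation.
move=> H x y z g f; have := st_comp (lwhisk H t) g f.
by rewrite /= fmap1 cmp1m fmapM -(cmpA (fmap _ _)).
Qed.

Definition precomp_counit :
  strong_trans (ps_functor_comp (precomp C F) (precomp C G))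
               (ps_functor_id (psfunctor_bicat A C)).
Proof.
apply: (@pointwise_trans _ _ _ (ps_functor_comp (precomp C F) (precomp C G))
  (ps_functor_id (psfunctor_bicat A C)) whisk_counit
  (fun H K u x => st_hom (u : strong_trans H K) (t x))).
- by move=> H K u x y f; have := lwhisk_nat t u f; rewrite /=.
- by move=> H K u v m x; apply: mod_inv_nat.
- by move=> H x; rewrite /= cmp1m !comp2_1 cmpm1 cmp1m.
- by move=> H K L v u x; rewrite /= cmp1m !comp2_1 cmpm1 cmp1m.
Defined.

End Counit.

Variable s : strong_trans (ps_functor_id A) (ps_functor_comp G F).
Variable t : strong_trans (ps_functor_comp G F) (ps_functor_id A).

Definition precomp_inv_unit
    (j : @iso (trans_cat _ _) (trans_id (ps_functor_id A)) (trans_comp t s)) :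
  @iso (trans_cat _ _) (trans_id (ps_functor_id (psfunctor_bicat A C)))
    (trans_comp (precomp_counit t) (precomp_unit s)).
Proof.
apply: (@pointwise_iso _ _ _ _ _
  (trans_id (ps_functor_id (psfunctor_bicat A C)))
  (trans_comp (precomp_counit t) (precomp_unit s)) (lwhisk_inv j)).
- by move=> H x y f; have := lwhisk_invN j H f; rewrite /=.
- move=> H K u x; have := lwhisk_inv_hom j u x.
  by rewrite st_at_comp st_at_id /=.
Qed.

Definition precomp_inv_counit
    (j : @iso (trans_cat _ _) (trans_id (ps_functor_comp G F))
              (trans_comp s t)) :
  @iso (trans_cat _ _)
    (trans_id (ps_functor_comp (precomp C F) (precomp C G)))
    (trans_comp (precomp_unit s) (precomp_counit t)).
Proof.
apply: (@pointwise_iso _ _ _ _ _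
  (trans_id (ps_functor_comp (precomp C F) (precomp C G)))
  (trans_comp (precomp_unit s) (precomp_counit t)) (lwhisk_inv j)).
- by move=> H x y f; have := lwhisk_invN j H f; rewrite /=.
- move=> H K u x; have := lwhisk_inv_hom j u x.
  by rewrite st_at_comp st_at_id /=.
Qed.

Lemma precomp_quasi_inverse :
  @quasi_inverse A A (ps_functor_id A) (ps_functor_comp G F) s t ->
  @quasi_inverse (psfunctor_bicat A C) (psfunctor_bicat A C)
    (ps_functor_id _) (ps_functor_comp (precomp C F) (precomp C G))
    (precomp_unit s) (precomp_counit t).
Proof.
case=> [[j] [k]]; split; apply: inhabits.
  exact: precomp_inv_unit j.
exact: iso_inv (precomp_inv_counit (iso_inv k)).
Qed.

End PrecompEquivalence.

Lemma quasi_inverse_sym (A B : bicat) (F G : psfunctor_bicat A B)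
    (s : bhom F G) (t : bhom G F) : quasi_inverse s t -> quasi_inverse t s.
Proof. by case=> [[j] [k]]; split; apply: inhabits; apply: iso_inv. Qed.

(** * Invariance of pseudofunctor bicategories under biequivalence *)

(** The unit of the induced biequivalence comes from the unit of the given one.
Its counit is the transformation that precomp_counit makes of the given
counit, with the roles of A and B exchanged. *)
Lemma biequivalent_psfunctor_bicat (A B C : bicat) :
  biequivalent A B ->
  biequivalent (psfunctor_bicat A C) (psfunctor_bicat B C).
Proof.
case=> [[F G s t [s' Hs] [t' Ht]]]; apply: inhabits.
apply: (@Biequivalence _ _ (precomp C G) (precomp C F)
  (precomp_unit C s) (precomp_counit C t)).
  by exists (precomp_counit C s'); apply: precomp_quasi_inverse.
exists (precomp_unit C t'); apply: quasi_inverse_sym.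
by apply: precomp_quasi_inverse; apply: quasi_inverse_sym.
Qed.

Local Open Scope ring_scope.

Theorem theorem2 (k : fieldType) (char_k : [pchar k] =i pred0)
    (G G' : coherent_2group) :
  biequivalent (deloop G) (deloop G') ->
  biequivalent (two_rep k G) (two_rep k G').
Proof. exact: biequivalent_psfunctor_bicat. Qed.
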